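(* Let $\mathcal{X}$ be a complex Banach space, let $A, B\in \mathcal{B}(\mathcal{X})$ be nonzero operators, and let $\mu_{A,B}\colon \mathcal{B}(\mathcal{X})\to\mathcal{B}(\mathcal{X})$ be the multiplication operator $\mu_{A,B}(X)=AXB$. (a) If $\theta_{\mu_{A,B}}>0$, then $\theta_A>0$ and $\theta_{B^*}>0$. (b) If $\theta_A>0$ and $\theta_{B^*}>0$ and the ranges $\mathscr{R}(A)$ and $\mathscr{R}(B)$ are closed, then $\theta_{\mu_{A,B}}>0$.
   Context: $\mathcal{B}(\mathcal{X})$ is the Banach algebra of all bounded linear operators on a complex Banach space $\mathcal{X}$, with the operator norm; $\mathcal{X}^*$ is the dual space and $B^*\in\mathcal{B}(\mathcal{X}^* )$ is the (Banach space) adjoint of $B$. $\mathscr{N}(T)$ and $\mathscr{R}(T)$ denote the null space and the range of a bounded operator $T$. For nonzero linear submanifolds (not necessarily closed) $\mathscr{K},\mathscr{M}$ of a Banach space, the angle $\angle(\mathscr{K},\mathscr{M})\in[0,\pi/2]$ is defined by $\sin(\angle(\mathscr{K},\mathscr{M}))=\inf\{\|x-y\| : x\in\mathscr{K},\ \|x\|=1,\ y\in\mathscr{M}\}$. If $\mathscr{K}=\{0\}$ or $\mathscr{M}=\{0\}$, then by convention $\sin(\angle(\mathscr{K},\mathscr{M}))=1$. For a bounded operator $T$ on a Banach space, $\theta_T=\angle(\mathscr{N}(T),\mathscr{R}(T))$. For $\mu_{A,B}$ the underlying Banach space is $\mathcal{B}(\mathcal{X})$; for $B^*$ it is $\mathcal{X}^*$.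 *)

(* Defs.v *)
From HB Require Import structures.
From mathcomp Require Import all_boot all_order all_algebra.
From mathcomp Require Import complex.
From mathcomp Require Import all_classical all_reals all_analysis.

Set Implicit Arguments.
Unset Strict Implicit.
Unset Printing Implicit Defensive.

Import Order.TTheory GRing.Theory Num.Theory.
Import numFieldNormedType.Exports.

Local Open Scope classical_set_scope.
Local Open Scope ring_scope.
Local Open Scope complex_scope.

(* A complex normed module has its norm in R[i]; `rnorm x` is that norm as an
   element of R. *)
Definition rnorm {R : realType} {V : normedModType R[i]} (x : V) : R :=
  complex.Re `|x|.

Section RealNorm.
Context {R : realType} {V : normedModType R[i]}.
Implicit Types x y : V.

Lemma rnormE x : `|x| = (rnorm x)%:C.
Proof. exact/esym/RRe_real/normr_real. Qed.

Lemma rnorm_ge0 x : 0 <= rnorm x.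
Proof. by have := normr_ge0 x; rewrite rnormE lecR. Qed.

Lemma ler_rnormD x y : rnorm (x + y) <= rnorm x + rnorm y.
Proof. by have := ler_normD x y; rewrite !rnormE -rmorphD lecR. Qed.

Lemma rnormZ (c : R[i]) x : rnorm (c *: x) = complex.Re `|c| * rnorm x.
Proof. by have := normrZ c x; rewrite !rnormE normc_def -rmorphM => -[]. Qed.

Lemma rnorm0 : rnorm (0 : V) = 0.
Proof. by rewrite /rnorm normr0. Qed.

Lemma rnorm0_eq0 x : rnorm x = 0 -> x = 0.
Proof. by move=> x0; apply/eqP; rewrite -normr_eq0 rnormE x0. Qed.

End RealNorm.

Section BoundedOperators.
Context {R : realType} (V W : normedModType R[i]).

Definition linear_bounded : {pred V -> W} :=
  fun f => `[< linear f /\ exists M : R, forall x, rnorm (f x) <= M * rnorm x >].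

Lemma linear_bounded_submod : submod_closed linear_bounded.
Proof.
have zE x : (0 : V -> W) x = 0 by [].
split.
  apply/asboolP; split.
    by move=> a x y; rewrite !zE scaler0 addr0.
  by exists 0 => x; rewrite mul0r zE rnorm0.
move=> a f g /asboolP[lf [M fM]] /asboolP[lg [N gN]]; apply/asboolP; split.
  move=> b x y; rewrite !fctE lf lg !scalerDr !scalerA mulrC -!addrA.
  by congr (_ + _); rewrite addrCA.
exists (complex.Re `|a| * M + N) => x; rewrite !fctE.
rewrite (le_trans (ler_rnormD _ _))// rnormZ mulrDl lerD// -mulrA ler_wpM2l//.
by rewrite normc_def /= sqrtr_ge0.
Qed.

HB.instance Definition _ :=
  GRing.isSubmodClosed.Build R[i] (V -> W) linear_bounded linear_bounded_submod.

Record bop := Bop { bop_fun :> V -> W; bopP : bop_fun \in linear_bounded }.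

HB.instance Definition _ := [isSub for bop_fun].
HB.instance Definition _ := [Choice of bop by <:].
HB.instance Definition _ := [SubChoice_isSubLmodule of bop by <:].


Implicit Types f g : bop.

Lemma bopD f g x : (f + g) x = f x + g x. Proof. by []. Qed.
Lemma bopZ (a : R[i]) f x : (a *: f) x = a *: f x. Proof. by []. Qed.

Lemma bop_linear f : linear f.
Proof. by have /asboolP[] := bopP f. Qed.

HB.instance Definition _ f :=
  GRing.isLinear.Build R[i] V W *:%R (bop_fun f) (bop_linear f).

Lemma bop_ext f g : f =1 g -> f = g.
Proof. by move=> fg; apply/val_inj/funext. Qed.

(* The unit ball contains 0 and the set is bounded above, see opnorm_has_sup. *)
Definition opnorm f : R := sup [set rnorm (f x) | x in [set x | rnorm x <= 1]].

Lemma opnorm_has_sup f :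
  has_sup [set rnorm (f x) | x in [set x | rnorm x <= 1]].
Proof.
split; first by exists (rnorm (f 0)), 0 => //=; rewrite rnorm0.
have /asboolP[_ [M fM]] := bopP f; exists `|M| => _ [x /= x1 <-].
rewrite (le_trans (fM x))// (le_trans (ler_norm _))// normrM ler_piMr//.
by rewrite ger0_norm ?rnorm_ge0.
Qed.

Lemma le_opnorm f x : rnorm (f x) <= opnorm f * rnorm x.
Proof.
have [->|x0] := eqVneq x 0; first by rewrite linear0 !rnorm0 mulr0.
have nx0 : 0 < rnorm x.
  by rewrite lt_neqAle rnorm_ge0 andbT eq_sym; apply: contraNneq x0 => /rnorm0_eq0 ->.
rewrite -ler_pdivrMr// mulrC.
have cE (c : R) : 0 <= c -> complex.Re `|c%:C| = c.
  by move=> c0; rewrite normc_def /= expr0n /= addr0 sqrtr_sqr ger0_norm.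
have -> : (rnorm x)^-1 * rnorm (f x) = rnorm (f ((rnorm x)^-1%:C *: x)).
  by rewrite linearZ/= rnormZ cE// invr_ge0 ltW.
apply: (sup_upper_bound (opnorm_has_sup f)) => /=; eexists; last by [].
by rewrite /= rnormZ cE ?invr_ge0 ?(ltW nx0)// mulVf// gt_eqF.
Qed.

Lemma opnorm_ge0 f : 0 <= opnorm f.
Proof.
apply: (le_trans (rnorm_ge0 (f 0))).
by apply: (sup_upper_bound (opnorm_has_sup f)); exists 0 => //=; rewrite rnorm0.
Qed.

Lemma opnorm_le f (M : R) : 0 <= M -> (forall x, rnorm (f x) <= M * rnorm x) ->
  opnorm f <= M.
Proof.
move=> M0 fM; apply: ge_sup; first by case: (opnorm_has_sup f).
by move=> _ [x /= x1 <-]; rewrite (le_trans (fM x))// ler_piMr.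
Qed.

Lemma ler_opnormD f g : opnorm (f + g) <= opnorm f + opnorm g.
Proof.
apply: opnorm_le => [|x]; first by rewrite addr_ge0 ?opnorm_ge0.
by rewrite bopD (le_trans (ler_rnormD _ _))// mulrDl lerD ?le_opnorm.
Qed.

Lemma opnormZ_le (a : R[i]) f : opnorm (a *: f) <= complex.Re `|a| * opnorm f.
Proof.
have a0 : 0 <= complex.Re `|a| by rewrite normc_def /= sqrtr_ge0.
apply: opnorm_le => [|x]; first by rewrite mulr_ge0 ?opnorm_ge0.
by rewrite bopZ rnormZ -mulrA ler_wpM2l ?le_opnorm.
Qed.

Lemma opnorm0 : opnorm 0 = 0.
Proof.
apply/eqP; rewrite eq_le opnorm_ge0 andbT; apply: opnorm_le => // x.
by rewrite mul0r rnorm0.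
Qed.

Lemma opnormZ (a : R[i]) f : opnorm (a *: f) = complex.Re `|a| * opnorm f.
Proof.
have [->|a0] := eqVneq a 0; first by rewrite scale0r opnorm0 normr0 mul0r.
apply/eqP; rewrite eq_le opnormZ_le andTb.
have na0 : 0 < complex.Re `|a|.
  by have := a0; rewrite -normr_gt0 normc_def ltcR.
rewrite -ler_pdivlMl//.
rewrite -{1}(scale1r f) -(mulVf a0) -scalerA (le_trans (opnormZ_le _ _))//.
by rewrite normfV !normc_def -fmorphV.
Qed.

Lemma opnorm0_eq0 f : opnorm f = 0 -> f = 0.
Proof.
move=> f0; apply: bop_ext => x; apply: rnorm0_eq0; apply/eqP.
by rewrite eq_le rnorm_ge0 andbT (le_trans (le_opnorm f x))// f0 mul0r.
Qed.

Let opnormC f : R[i] := (opnorm f)%:C.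

Let ler_opnormCD f g : opnormC (f + g) <= opnormC f + opnormC g.
Proof. by rewrite /opnormC -rmorphD lecR ler_opnormD. Qed.

Let opnormCZ (a : R[i]) f : opnormC (a *: f) = `|a| * opnormC f.
Proof. by rewrite /opnormC opnormZ normc_def -rmorphM. Qed.

Let opnormC0_eq0 f : opnormC f = 0 -> f = 0.
Proof. by rewrite /opnormC => -[/opnorm0_eq0]. Qed.

(* `Lmodule_isNormed` also equips bop with the topology induced by the norm. *)
HB.instance Definition _ := Lmodule_isNormed.Build R[i] bop
  ler_opnormCD opnormCZ opnormC0_eq0.

Lemma rnorm_bop f : rnorm f = opnorm f.
Proof. by []. Qed.

End BoundedOperators.

Arguments linear_bounded {R} V W _.

Section Angle.
Context {R : realType} {V : normedModType R[i]}.
Implicit Types K M : set V.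

(* The first branch is the convention for a trivial submanifold. *)
Definition sin_angle K M : R :=
  if `[< K = [set 0] \/ M = [set 0] >] then 1
  else inf [set r | exists x y, [/\ K x, rnorm x = 1, M y & r = rnorm (x - y)]].

(* For M containing 0, the value lies in [0, pi/2] and its sine is
   sin_angle K M, see angle_itv and sin_angleE. *)
Definition angle K M : R := asin (sin_angle K M).

Lemma sin_angle_itv K M : M 0 -> 0 <= sin_angle K M <= 1.
Proof.
move=> M0; rewrite /sin_angle; case: asboolP => _; first by rewrite ler01 lexx.
set S := [set r | _].
have S0 : lbound S 0 by move=> _ [x [y [_ _ _ ->]]]; exact: rnorm_ge0.
have [[r Sr]|/set0P/negP/negPn/eqP ->] := pselect (S !=set0); last first.
  by rewrite inf0 lexx ler01.
apply/andP; split; first by apply: lb_le_inf => //; exists r.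
have [x [y [Kx x1 _ _]]] := Sr.
by apply: ge_inf; [exists 0 | exists x, 0; split=> //; rewrite subr0].
Qed.

Lemma sin_angleE K M : M 0 -> sin (angle K M) = sin_angle K M.
Proof.
move=> /(sin_angle_itv K)/andP[s0 s1]; have [//|_ ->//] := asin_def (x := sin_angle K M).
by rewrite s1 (le_trans _ s0)// lerN10.
Qed.

Lemma angle_itv K M : M 0 -> 0 <= angle K M <= pi / 2.
Proof.
move=> M0; have /andP[s0 s1] := sin_angle_itv K M0.
have sB : -1 <= sin_angle K M <= 1 by rewrite s1 (le_trans _ s0)// lerN10.
rewrite asin_lepi2// andbT leNgt; apply/negP => a0.
have : 0 < sin (- angle K M).
  rewrite sin_gt0_pi// oppr_gt0 a0/= (@le_lt_trans _ _ (pi / 2))//.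
    by rewrite lerNl asin_geNpi2.
  by rewrite ltr_pdivrMr// ltr_pMr ?pi_gt0// ltr1n.
by rewrite sinN sin_angleE// oppr_gt0 ltNge s0.
Qed.

End Angle.

Section OperatorConstructions.
Context {R : realType}.
Implicit Types U V W : normedModType R[i].

Lemma linear_bounded_comp U V W (f : bop V W) (g : bop U V) :
  (fun x => f (g x)) \in linear_bounded U W.
Proof.
apply/asboolP; split=> [a x y|]; first by rewrite !linearP.
exists (opnorm f * opnorm g) => x; rewrite (le_trans (le_opnorm _ _))// -mulrA.
by rewrite ler_wpM2l ?opnorm_ge0 ?le_opnorm.
Qed.

Definition bop_comp U V W (f : bop V W) (g : bop U V) : bop U W :=
  Bop (linear_bounded_comp f g).

Lemma opnorm_comp U V W (f : bop V W) (g : bop U V) :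
  opnorm (bop_comp f g) <= opnorm f * opnorm g.
Proof.
apply: opnorm_le => [|x]; first by rewrite mulr_ge0 ?opnorm_ge0.
rewrite (le_trans (le_opnorm f (g x)))// -mulrA.
by rewrite ler_wpM2l ?opnorm_ge0 ?le_opnorm.
Qed.

Definition dual V : normedModType R[i] := bop V R[i]^o.

Lemma linear_bounded_adjoint V W (B : bop V W) :
  (fun f : dual W => bop_comp f B : dual V) \in linear_bounded (dual W) (dual V).
Proof.
apply/asboolP; split=> [a f g|]; first exact: bop_ext.
by exists (opnorm B) => f; rewrite mulrC; exact: opnorm_comp.
Qed.

(* The Banach space adjoint f |-> f o B (linear, not conjugate-linear, in B). *)
Definition adjoint V W (B : bop V W) : bop (dual W) (dual V) :=
  Bop (linear_bounded_adjoint B).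

Lemma linear_bounded_mulop V (A B : bop V V) :
  (fun X : bop V V => bop_comp A (bop_comp X B))
    \in linear_bounded (bop V V) (bop V V).
Proof.
apply/asboolP; split=> [a f g|]; first by apply: bop_ext => x; exact: linearP.
exists (opnorm A * opnorm B) => X; rewrite (le_trans (opnorm_comp _ _))//.
by rewrite -mulrA ler_wpM2l ?opnorm_ge0// mulrC opnorm_comp.
Qed.

Definition mulop V (A B : bop V V) : bop (bop V V) (bop V V) :=
  Bop (linear_bounded_mulop A B).

Definition nullspace V W (T : bop V W) : set V := T @^-1` [set 0].

Definition theta V (T : bop V V) : R := angle (nullspace T) (range T).

End OperatorConstructions.

(* Main.v *)
(* The angle of T is positive iff c |x| <= |x - T y| for some c > 0, all x in the
   null space of T and all y.

   (a) Test this inequality for mu_{A,B} on the rank-one operators [x, f] : u |->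
   f(u) x, for which mu_{A,B} [x, f] = [A x, B^*f]: use [x, B^*g] and [y, g] with
   x in N(A), then [A a, f] and [a, g] with f in N(B^* ).

   (b) By the open mapping theorem, a closed range and a positive angle make A
   bounded below on its own range; by Hahn-Banach, B^* inherits from B the lifts
   with norm control, so B^* is bounded below on R(B^* ). Let A S B = 0, W = A Y B
   and Z = S - W. Then A W B = - A Z B, so the bound for A gives
   |W B| <= C |Z|, and the bound for B^*, applied to the functionals f o W, which
   lie in R(B^* ), removes the factor B: |W| <= C' |Z|, hence |S| <= (1 + C') |Z|. *)
Require Import Defs.
From HB Require Import structures.
From mathcomp Require Import all_boot all_order all_algebra.
From mathcomp Require Import complex.
From mathcomp Require Import all_classical all_reals all_analysis.
From mathcomp Require Import ring lra.

Import Order.TTheory GRing.Theory Num.Theory.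
Import numFieldNormedType.Exports.

Local Open Scope classical_set_scope.
Local Open Scope ring_scope.
Local Open Scope complex_scope.

(** * The real-valued norm, closed sets and powers of one half *)

Section RealNormFacts.
Context {R : realType} {V : normedModType R[i]}.
Implicit Types x y : V.

Lemma rnormN x : rnorm (- x) = rnorm x.
Proof. by rewrite /rnorm normrN. Qed.

Lemma rnormB x y : rnorm (x - y) = rnorm (y - x).
Proof. by rewrite -rnormN opprB. Qed.

Lemma rnorm_gt0 x : x != 0 -> 0 < rnorm x.
Proof.
move=> x0; rewrite lt_neqAle rnorm_ge0 andbT eq_sym.
by apply: contraNneq x0 => /rnorm0_eq0 ->.
Qed.

Lemma rnormZr (t : R) x : 0 <= t -> rnorm (t%:C *: x) = t * rnorm x.
Proof.
by move=> t0; rewrite rnormZ normc_def /= expr0n addr0 sqrtr_sqr ger0_norm.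
Qed.

Lemma closed_rnorm (S : set V) x : closed S ->
  (forall e : R, 0 < e -> exists2 s, S s & rnorm (x - s) < e) -> S x.
Proof.
move=> cS xS; apply: cS => U /nbhs_ballP[e /= e0 eU].
have e0' : 0 < complex.Re e by move: e0; rewrite ltcE /= => /andP[].
have [s Ss xs] := xS _ e0'; exists s; split=> //; apply: eU.
rewrite -ball_normE /ball_/= rnormE.
have -> : e = (complex.Re e)%:C by apply/esym/RRe_real/gtr0_real.
by rewrite ltcR.
Qed.

End RealNormFacts.

Lemma exp2V_lt {R : realType} (C e : R) : 0 < e -> exists n, C * 2 ^- n < e.
Proof.
move=> e0; have [C0|C0] := leP C 0.
  by exists 0%N; rewrite expr0 invr1 mulr1 (le_lt_trans C0).
have Ce : 0 < C / e by rewrite divr_gt0.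
exists (Num.truncn (C / e)).+1.
rewrite ltr_pdivrMr ?exprn_gt0// mulrC -ltr_pdivrMr//.
rewrite (lt_trans (truncnS_gt _))// -natrX ltr_nat.
exact: ltn_expl.
Qed.

(** * Sequences with geometrically decreasing steps *)

Section Complete.
Context {R : realType} {V : completeNormedModType R[i]}.

(** Since [r] at least halves, a step of size [r n / 2] is at most [r n - r n.+1]; the bounds
    telescope, so [u] is Cauchy. *)
Lemma rnorm_cauchy_cvg (u : nat -> V) (r : nat -> R) :
  (forall n, r n.+1 <= r n / 2) -> (forall n, rnorm (u n.+1 - u n) <= r n / 2) ->
  exists l, forall n, rnorm (l - u n) <= r n.
Proof.
move=> rS uS.
have r0 n : 0 <= r n by have := uS n; have := rnorm_ge0 (u n.+1 - u n); lra.
have ru n m : rnorm (u (n + m)%N - u n) <= r n - r (n + m)%N.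
  elim: m => [|m ih]; first by rewrite addn0 !subrr rnorm0.
  rewrite addnS -(subrKA (u (n + m)%N)) (le_trans (ler_rnormD _ _))//.
  by have := uS (n + m)%N; have := rS (n + m)%N; lra.
have rn n : r n <= r 0%N * 2 ^- n.
  elim: n => [|n ih]; first by rewrite expr0 invr1 mulr1.
  by rewrite (le_trans (rS n))// exprSr invfM mulrA ler_pM2r// invr_gt0.
have cu : cvg (u @ \oo).
  apply/cauchy_cvgP/cauchy_exP => e e0.
  have e0' : 0 < complex.Re e by move: e0; rewrite ltcE /= => /andP[].
  have -> : e = (complex.Re e)%:C by apply/esym/RRe_real/gtr0_real.
  have [n rne] := exp2V_lt (r 0%N) _ e0'.
  exists (u n); exists n => // m /= nm.
  rewrite -ball_normE /ball_/= rnormE ltcR rnormB -(subnKC nm).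
  rewrite (le_lt_trans (ru _ _))// (le_lt_trans _ rne)// (le_trans _ (rn n))//.
  by rewrite lerBlDr lerDl.
exists (lim (u @ \oo)) => n; apply/ler_addgt0Pr => e e0.
have /cvgrPdist_lt/(_ e%:C) := cu; rewrite ltcR => /(_ e0)[N _ Nu].
have := Nu (N + n)%N (leq_addr _ _); rewrite rnormE ltcR => lu.
rewrite -(subrKA (u (N + n)%N)) (le_trans (ler_rnormD _ _))// addrC lerD ?(ltW lu)//.
by rewrite addnC (le_trans (ru _ _))// lerBlDr lerDl.
Qed.

End Complete.

(** * Open mapping theorem for an operator with closed range *)

Section OpenMapping.
Context {R : realType} {U V : completeNormedModType R[i]} (T : bop U V).
Hypothesis T_closed : closed (range T).

(* Baire's nested balls inside the complete set [range T], which is the union of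
   the images of the balls of radius [n]. *)
Lemma range_locally_approx : exists N (y0 : U) (r : R), 0 < r /\
  forall y, rnorm (T y - T y0) <= r -> forall e : R, 0 < e ->
  exists2 x, rnorm x <= N & rnorm (T y - T x) < e.
Proof.
apply: contrapT => noN.
have next (s : nat * (U * R)) : exists t : U * R, 0 < s.2.2 ->
    [/\ 0 < t.2, t.2 <= s.2.2 / 2, rnorm (T t.1 - T s.2.1) <= s.2.2 / 2 &
      forall x, rnorm x <= s.1%:R -> t.2 < rnorm (T t.1 - T x)].
  case: s => n [y0 r] /=; have [r0|r0] := ltP 0 r; last by exists (y0, r).
  apply: contrapT => no; apply: noN; exists n%:R, y0, (r / 2).
  split=> [|y yr e e0]; first by rewrite divr_gt0.
  (* Here [T y] stays at distance at least [e] from the image of the [n]-ball: [r / 2] keeps the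
     balls nested, [e / 2] makes the separation strict. *)
  apply: contrapT => nox; apply: no; exists (y, Num.min (r / 2) (e / 2)) => _ /=.
  split=> //; first by rewrite lt_min !divr_gt0.
    by rewrite ge_min lexx.
  move=> x xn; rewrite (@le_lt_trans _ _ (e / 2)) ?ge_min ?lexx ?orbT//.
  have ex : e <= rnorm (T y - T x).
    by rewrite leNgt; apply/negP => xe; apply: nox; exists x.
  by rewrite (lt_le_trans _ ex)//; lra.
have [f fP] := choice next.
pose s := fix s n := if n is n'.+1 then f (n', s n') else (0 : U, 1 : R).
have s0 n : 0 < (s n).2 by elim: n => //= n ih; case: (fP (n, s n) ih).
have sP n := fP (n, s n) (s0 n).
have [|n|l lP] := @rnorm_cauchy_cvg _ V (fun n => T (s n).1) (fun n => (s n).2).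
- by move=> n; case: (sP n).
- by case: (sP n).
have [x _ Tx] : range T l.
  apply: closed_rnorm => // e e0; have [n ne] := exp2V_lt 1 _ e0.
  exists (T (s n).1); first by exists (s n).1.
  rewrite (le_lt_trans (lP n))// (le_lt_trans _ ne)// mul1r.
  elim: {ne} n => [|n ih]; first by rewrite expr0 invr1.
  have [_ h _ _] := sP n; rewrite (le_trans h)//= exprSr invfM.
  by rewrite ler_pM2r// invr_gt0.
(* The limit is [T x], but the ball chosen at a stage exceeding the norm of [x] excludes [T x],
   although it contains the limit. *)
have [_ _ _ /(_ x (ltW (truncnS_gt _)))] := sP (Num.truncn (rnorm x)).+1.
rewrite ltNge rnormB Tx => /negP; apply; exact: (lP (Num.truncn (rnorm x)).+2).
Qed.

(** The local approximation is moved to the origin by subtracting approximants of two points of the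
    ball, then extended to all of the range by scaling. *)
Lemma range_approx : exists2 K : R, 0 <= K & forall y (e : R), 0 < e ->
  exists2 x, rnorm x <= K * rnorm (T y) & rnorm (T y - T x) < e.
Proof.
have [N [y0 [r [r0 approx]]]] := range_locally_approx.
have N0 : 0 <= N.
  have [|x xN _] := approx y0 _ 1 ltr01; first by rewrite subrr rnorm0; exact: ltW.
  exact: le_trans (rnorm_ge0 _) xN.
exists (2 * N / r) => [|y e e0]; first by rewrite divr_ge0 ?mulr_ge0 ?(ltW r0).
have [Ty0|/rnorm_gt0 Ty0] := eqVneq (T y) 0.
  by exists 0; rewrite ?Ty0 ?linear0 ?addr0 ?rnorm0 ?rnorm0 ?mulr0.
(* This [t] puts [T (y0 + t y)] exactly at distance [r] from [T y0]. Two errors below [t * e / 2],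
   divided by [t], add up to less than [e]. *)
pose t := r / rnorm (T y).
have t0 : 0 < t by rewrite divr_gt0.
have e'0 : 0 < t * e / 2 by rewrite divr_gt0// mulr_gt0.
have [|x1 x1N x1e] := approx (y0 + t%:C *: y) _ _ e'0.
  by rewrite linearD linearZ/= addrC addKr rnormZr ?(ltW t0)// divfK// gt_eqF.
have [|x2 x2N x2e] := approx y0 _ _ e'0; first by rewrite subrr rnorm0; exact: ltW.
have tV0 : 0 <= t^-1 by rewrite invr_ge0 ltW.
exists (t^-1%:C *: (x1 - x2)).
  have -> : 2 * N / r * rnorm (T y) = t^-1 * (2 * N) by rewrite /t invf_div; ring.
  rewrite rnormZr// ler_wpM2l// (le_trans (ler_rnormD _ _))// rnormN.
  by rewrite mulr_natl mulr2n lerD.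
have -> : T y - T (t^-1%:C *: (x1 - x2)) =
    t^-1%:C *: ((T (y0 + t%:C *: y) - T x1) - (T y0 - T x2)).
  have -> : T (y0 + t%:C *: y) - T x1 - (T y0 - T x2) =
      t%:C *: T y - T (x1 - x2).
    rewrite (linearD T y0) (linearB T x1) linearZ/= opprB [RHS]addrC opprB.
    by rewrite [LHS]addrC -[T y0 + _ - _]addrA subrKA -[RHS]addrA [- T x1 + _]addrC.
  by rewrite [RHS]scalerBr scalerA -rmorphM mulVf ?gt_eqF// scale1r -linearZ.
rewrite rnormZr// mulrC ltr_pdivrMr// (le_lt_trans (ler_rnormD _ _))// rnormN.
by rewrite mulrC; lra.
Qed.

(** Successive corrections halve the remainder [T y - T (s n)]; they form a geometric series, whence
    the factor 2 in the constant, and completeness of [U] sums it. *)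
Lemma closed_range_lift : exists2 K : R, 0 <= K & forall y,
  exists2 x, T x = T y & rnorm x <= K * rnorm (T y).
Proof.
have [K K0 approx] := range_approx.
exists (2 * K) => [|y]; first by rewrite mulr_ge0.
have next s : exists d, rnorm d <= K * rnorm (T y - T s) /\
    rnorm (T y - T s - T d) <= rnorm (T y - T s) / 2.
  have [ys|/rnorm_gt0 ys] := eqVneq (T y - T s) 0.
    by exists 0; rewrite linear0 ys subr0 !rnorm0 mulr0 mul0r.
  have [|d dK ds] := approx (y - s) (rnorm (T y - T s) / 2).
    by rewrite divr_gt0.
  by exists d; rewrite linearB in dK ds; rewrite dK ltW.
have [f fP] := choice next.
pose s := fix s n := if n is n'.+1 then s n' + f (s n') else (0 : U).
pose r n := rnorm (T y) * 2 ^- n.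
have rS n : r n.+1 = r n / 2 by rewrite /r exprSr invfM mulrA.
have sr n : rnorm (T y - T (s n)) <= r n.
  elim: n => [|n ih]; first by rewrite /r /= linear0 subr0 expr0 invr1 mulr1.
  have [_ h] := fP (s n); rewrite /= linearD opprD addrA (le_trans h)// rS.
  by rewrite ler_pM2r ?invr_gt0.
have [n|n|l lP] := @rnorm_cauchy_cvg _ U s (fun n => 2 * K * r n).
- by rewrite rS mulrA.
- have [h _] := fP (s n); rewrite /= [s n + _]addrC addrK (le_trans h)//.
  by have := ler_wpM2l K0 (sr n); lra.
have K2 := mulr_ge0 (ler0n _ 2) K0.
exists l; last by have := lP 0%N; rewrite subr0 /r expr0 invr1 mulr1.
apply/eqP; rewrite -subr_eq0; apply/eqP/rnorm0_eq0/eqP.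
rewrite eq_le rnorm_ge0 andbT; apply/ler_addgt0Pr => e e0; rewrite add0r.
have [n /ltW ne] := exp2V_lt ((opnorm T * (2 * K) + 1) * rnorm (T y)) _ e0.
apply: le_trans ne; rewrite -mulrA -/(r n) mulrDl mul1r.
rewrite -(subrKA (T (s n))) (le_trans (ler_rnormD _ _))// lerD//.
  rewrite -linearB (le_trans (le_opnorm _ _))// -mulrA.
  by rewrite ler_wpM2l ?opnorm_ge0 ?(lP n).
by rewrite rnormB.
Qed.

End OpenMapping.

(** * Real Hahn-Banach theorem through minimal sublinear functionals *)

Section Sublinear.
Context {R : realType} {V : lmodType R[i]}.
Implicit Types (p q : V -> R) (C : set (V * R)).

Definition sublinear q := (forall x y, q (x + y) <= q x + q y) /\
  (forall (t : R) x, 0 <= t -> q (t%:C *: x) = t * q x).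

Lemma sublinear0 q : sublinear q -> q 0 = 0.
Proof. by case=> _ /(_ 0 0 (lexx _)); rewrite mul0r scaler0. Qed.

Lemma sublinear_geN q x : sublinear q -> - q (- x) <= q x.
Proof. by move=> sq; have := sq.1 x (- x); rewrite subrr sublinear0//; lra. Qed.

(* [q'] is the infimal convolution of [q] with [C]; at [x = - m.1] the last clause
   reads [q' (- m.1) <= - m.2]. *)
Lemma sublinear_cone q C : sublinear q -> C (0, 0) ->
  (forall m n, C m -> C n -> C (m.1 + n.1, m.2 + n.2)) ->
  (forall (t : R) m, 0 <= t -> C m -> C (t%:C *: m.1, t * m.2)) ->
  (forall m, C m -> m.2 <= q m.1) ->
  exists2 q', sublinear q' /\ (forall x, q' x <= q x) &
    forall x m, C m -> q' x <= q (x + m.1) - m.2.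
Proof.
move=> sq C0 CD CZ Cq.
pose S x := [set q (x + m.1) - m.2 | m in C].
have Slb x : has_lbound (S x).
  exists (- q (- x)) => _ [m Cm <-]; have := sq.1 (x + m.1) (- x).
  by rewrite addrC addKr; have := Cq _ Cm; lra.
pose q' x := inf (S x).
have le_q' x m : C m -> q' x <= q (x + m.1) - m.2.
  by move=> Cm; apply: ge_inf => //; exists m.
have q'_ge x a : (forall m, C m -> a <= q (x + m.1) - m.2) -> a <= q' x.
  move=> h; apply: lb_le_inf; first by exists (q (x + 0) - 0), (0, 0).
  by move=> _ [m Cm <-]; exact: h.
(* The opposite inequality will follow from this one applied to [t^-1]. *)
have q'Z_ge (t : R) x : 0 < t -> t * q' x <= q' (t%:C *: x).
  move=> t0; apply: (q'_ge) => m Cm.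
  have tV0 : 0 <= t^-1 by rewrite invr_ge0 ltW.
  have := le_q' x _ (CZ _ _ tV0 Cm); rewrite -(ler_pM2l t0) => /le_trans; apply.
  rewrite mulrBr mulrA mulfV ?gt_eqF// mul1r -sq.2 ?(ltW t0)// scalerDr scalerA.
  by rewrite -rmorphM mulfV ?gt_eqF// rmorph1 scale1r.
exists q' => //; split; last first.
  by move=> x; rewrite (le_trans (le_q' x _ C0))//= addr0 subr0.
split=> [x y|t x].
  rewrite -lerBlDr; apply: (q'_ge) => m Cm; rewrite lerBlDl -lerBlDr.
  apply: (q'_ge) => n Cn; have := le_q' (x + y) _ (CD _ _ Cm Cn).
  by rewrite /= addrACA; have := sq.1 (x + m.1) (y + n.1); lra.
rewrite le_eqVlt => /predU1P[<-|t0].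
  rewrite mul0r scale0r; apply/le_anti/andP; split.
    by rewrite (le_trans (le_q' 0 _ C0))//= addr0 subr0 (sublinear0 _ sq).
  by apply: (q'_ge) => m Cm; rewrite add0r subr_ge0 Cq.
apply/le_anti/andP; split; last exact: q'Z_ge.
rewrite -ler_pdivrMl// (le_trans (q'Z_ge _ _ _)) ?invr_gt0//.
by rewrite scalerA -rmorphM mulVf ?gt_eqF// scale1r.
Qed.

(** Zorn's lemma for the reversed pointwise order: a nonempty chain is bounded by its pointwise
    infimum, finite because every member is at least [- p (- x)]. *)
Lemma exists_minimal_sublinear p : sublinear p ->
  exists q, [/\ sublinear q, forall x, q x <= p x &
    forall q', sublinear q' -> (forall x, q' x <= q x) -> q' = q].
Proof.
move=> sp; pose X := {q | sublinear q /\ forall x, q x <= p x}.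
pose rl (q q' : X) := `[< forall x, sval q' x <= sval q x >].
have [||||[q [sq qp]] qmin] := @Zorn X rl.
- by move=> q; apply/asboolP.
- move=> q1 q2 q3 /asboolP h1 /asboolP h2; apply/asboolP => x.
  exact: le_trans (h1 x).
- move=> [q1 P1] [q2 P2] /asboolP/= h1 /asboolP/= h2; apply: eq_exist.
  by apply/funext => x; apply/le_anti; rewrite h1 h2.
- move=> A Atot; have [[q0 Aq0]|A0] := pselect (A !=set0); last first.
    exists (exist _ p (conj sp (fun x => lexx _))) => q Aq.
    by case: A0; exists q.
  pose S x := [set sval q x | q in A].
  have Slb x : has_lbound (S x).
    exists (- p (- x)) => _ [[q [sq qp]] Aq <-] /=.
    by rewrite (le_trans _ (sublinear_geN _ x sq))// lerN2.
  pose i x := inf (S x).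
  have le_i x (q : X) : A q -> i x <= sval q x.
    by move=> Aq; apply: ge_inf => //; exists q.
  have i_ge x a : (forall q : X, A q -> a <= sval q x) -> a <= i x.
    move=> h; apply: lb_le_inf; first by exists (sval q0 x), q0.
    by move=> _ [q Aq <-]; exact: h.
  have sZ (t : R) x (q : X) : 0 <= t -> sval q (t%:C *: x) = t * sval q x.
    by case: q => q [[? qZ] ?] /= t0; rewrite qZ.
  have sD x y (q : X) : sval q (x + y) <= sval q x + sval q y.
    by case: q => q [[]].
  have iP : sublinear i /\ forall x, i x <= p x.
    split; last by move=> x; rewrite (le_trans (le_i x _ Aq0))//; case: (q0) => ? [].
    split=> [x y|t x].
      rewrite -lerBlDr; apply: (i_ge) => q Aq; rewrite lerBlDl -lerBlDr.
      apply: (i_ge) => q' Aq'; rewrite lerBlDr.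
      (* Subadditivity of the infimum uses the chain: the smaller of [q] and [q'] serves for both
         summands. *)
      have [/asboolP h|/asboolP h] := Atot _ _ Aq Aq'.
        rewrite (le_trans (le_i _ _ Aq'))// (le_trans (sD _ _ _))// addrC.
        by rewrite lerD.
      rewrite (le_trans (le_i _ _ Aq))// (le_trans (sD _ _ _))// addrC.
      by rewrite lerD.
    rewrite le_eqVlt => /predU1P[<-|t0].
      rewrite mul0r scale0r.
      have q00 (q : X) : sval q 0 = 0 by case: q => q [sq /=]; rewrite sublinear0.
      apply/le_anti/andP; split; first by rewrite (le_trans (le_i 0 _ Aq0)) ?q00.
      by apply: (i_ge) => q _; rewrite q00.
    apply/eqP; rewrite eq_le; apply/andP; split.
      rewrite -ler_pdivrMl//; apply: (i_ge) => q Aq.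
      by rewrite ler_pdivrMl// -sZ ?(ltW t0)// le_i.
    apply: (i_ge) => q Aq; rewrite sZ ?(ltW t0)// ler_pM2l//; exact: le_i.
  by exists (exist _ i iP) => q Aq; apply/asboolP => x /=; exact: le_i.
exists q; split=> // q' sq' q'q.
have q'P : sublinear q' /\ forall x, q' x <= p x.
  by split=> // x; rewrite (le_trans (q'q x)).
by have /(congr1 sval) := qmin (exist _ q' q'P) (asboolT q'q).
Qed.

(* Apply [sublinear_cone] to the ray through [(y, q y)]: by minimality it leaves
   [q] unchanged, so [q x <= q (x + y) - q y]. *)
Lemma minimal_sublinear_additive q : sublinear q ->
  (forall q', sublinear q' -> (forall x, q' x <= q x) -> q' = q) ->
  forall x y, q (x + y) = q x + q y.
Proof.
move=> sq qmin x y; apply/eqP; rewrite eq_le sq.1/=.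
pose C : set (V * R) := [set (t%:C *: y, t * q y) | t in [set t | 0 <= t]].
have [||||q' [sq' /(qmin _ sq') ->] /(_ x (y, q y))] :=
    sublinear_cone q C sq.
- by exists 0; rewrite /= ?lexx// scale0r mul0r.
- move=> _ _ [t /= t0 <-] [s /= s0 <-]; exists (t + s); rewrite /= ?addr_ge0//.
  by rewrite rmorphD scalerDl mulrDl.
- move=> t _ t0 [s /= s0 <-]; exists (t * s); rewrite /= ?mulr_ge0//.
  by rewrite rmorphM scalerA mulrA.
- by move=> _ [t /= t0 <-] /=; rewrite sq.2.
by rewrite -lerBrDr; apply; exists 1; rewrite /= ?ler01// scale1r mul1r.
Qed.

(** The constraints in [C] are first absorbed into a smaller sublinear [p']. A minimal functional
    below [p'] is additive, hence real linear, and its value at [- m.1] yields the bound from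
    [C]. *)
Lemma hahn_banach_real p C : sublinear p -> C (0, 0) ->
  (forall m n, C m -> C n -> C (m.1 + n.1, m.2 + n.2)) ->
  (forall (t : R) m, 0 <= t -> C m -> C (t%:C *: m.1, t * m.2)) ->
  (forall m, C m -> m.2 <= p m.1) ->
  exists q, [/\ forall x y, q (x + y) = q x + q y,
    forall (t : R) x, q (t%:C *: x) = t * q x, forall x, q x <= p x &
    forall m, C m -> m.2 <= q m.1].
Proof.
move=> sp C0 CD CZ Cp.
have [p' [sp' p'p] p'C] := sublinear_cone p C sp C0 CD CZ Cp.
have [q [sq qp' qmin]] := exists_minimal_sublinear p' sp'.
have qD := minimal_sublinear_additive q sq qmin.
have qN x : q (- x) = - q x.
  by apply/eqP; rewrite -addr_eq0 -qD addNr sublinear0.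
exists q; split=> // [t x|x|m Cm].
- have [t0|t0] := leP 0 t; first exact: sq.2.
  rewrite -[t]opprK rmorphN scaleNr qN sq.2 ?mulNr// oppr_ge0 ltW//.
- exact: le_trans (qp' x) (p'p x).
have := le_trans (qp' (- m.1)) (p'C (- m.1) m Cm).
by rewrite qN addNr sublinear0// sub0r lerN2.
Qed.

End Sublinear.

(** * Complex Hahn-Banach theorem and norming functionals *)

Section ComplexHahnBanach.
Context {R : realType}.

Lemma Re_normc (z : R[i]) :
  complex.Re `|z| ^+ 2 = complex.Re z ^+ 2 + complex.Im z ^+ 2.
Proof. by rewrite normc_def /= sqr_sqrtr// addr_ge0// sqr_ge0. Qed.

(** The real theorem is applied to the graph of [T s |-> Re (k s)], given as a set of pairs, so that
    no functional on the range of [T] has to be constructed first. *)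
Lemma hahn_banach_factor (U : lmodType R[i]) (V : normedModType R[i])
    (T : {linear U -> V}) (k : {linear U -> R[i]^o}) (K : R) : 0 <= K ->
  (forall s, complex.Re `|k s| <= K * rnorm (T s)) ->
  exists2 g : dual V, opnorm g <= K & forall s, g (T s) = k s.
Proof.
move=> K0 kT.
have kZ (c : R[i]) s : k (c *: s) = c * k s by exact: linearZ_LR.
have sub : sublinear (fun x : V => K * rnorm x).
  split=> [x y|t x t0]; first by rewrite -mulrDr ler_wpM2l// ler_rnormD.
  by rewrite rnormZr// mulrCA.
pose C := range (fun s => (T s, complex.Re (k s))).
have [||||q [qD qZ qK qC]] := hahn_banach_real _ C sub.
- by exists 0 => //; rewrite linear0 linear0.
- move=> _ _ [s _ <-] [t _ <-]; exists (s + t) => //=.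
  by rewrite linearD linearD /=; case: (k s); case: (k t).
- move=> t _ _ [s _ <-]; exists (t%:C *: s) => //=.
  by rewrite linearZ kZ; case: (k s) => a b /=; rewrite mul0r subr0.
- move=> _ [s _ <-] /=; apply: le_trans (kT s).
  rewrite (le_trans (ler_norm _))// -(@ler_pXn2r _ 2) ?nnegrE ?normr_ge0//.
    by rewrite Re_normc real_normK ?num_real// lerDl sqr_ge0.
  by rewrite normc_def /= sqrtr_ge0.
have qN x : q (- x) = - q x
  by rewrite -scaleN1r -[-1](rmorphN1 (real_complex R)) qZ mulN1r.
(* The graph is closed under negation, so the one-sided bound becomes an equality. *)
have qT s : q (T s) = complex.Re (k s).
  apply/le_anti/andP; split; last exact: (qC _ (imageT _ s)).
  rewrite -[q _]opprK -qN -linearN lerNl.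
  have := qC _ (imageT _ (- s)); rewrite /= linearN [k (- s)]linearN.
  by case: (k s).
(* A complex linear functional is recovered from its real part [q] by this formula. *)
pose g x : R[i]^o := q x +i* - q ('i *: x).
have gl : linear g.
  move=> [a b] x y; rewrite /g.
  have E : (a +i* b) = a%:C + 'i * b%:C :> R[i] by exact: complexE.
  have qc z : q ((a +i* b) *: z) = a * q z + b * q ('i *: z).
    by rewrite E scalerDl qD qZ ['i * _]mulrC -scalerA qZ.
  rewrite scalerDr !qD scalerA mulrC -scalerA !qc scalerA -expr2 sqr_i scaleN1r qN.
  rewrite /GRing.scale /=; apply/eqP; rewrite eq_complex /=.
  by apply/andP; split; apply/eqP; ring.
have gK x : complex.Re `|g x| <= K * rnorm x.
  set n := complex.Re _.
  have n0 : 0 <= n by rewrite /n normc_def /= sqrtr_ge0.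
  have [->|n1] := eqVneq n 0; first by rewrite mulr_ge0 ?rnorm_ge0.
  have {}n0 : 0 < n by rewrite lt_neqAle eq_sym n1.
  rewrite -(ler_pM2l n0) -expr2 mulrCA.
  (* With [c] the conjugate of [g x], the value [q (c *: x)] is the squared modulus of [g x], so the
     bound on [q] gives the bound on [g]. *)
  pose c := complex.Re (g x) -i* complex.Im (g x).
  have cn : complex.Re `|c| = n by rewrite /n !normc_def /= sqrrN.
  rewrite -cn -rnormZ; apply: le_trans (qK _).
  rewrite cn Re_normc.
  have -> : q (c *: x) = complex.Re (g (c *: x)) by [].
  have -> : g (c *: x) = c * g x.
    have q0 : q 0 = 0 by rewrite -(subrr 0) qD qN subrr.
    have := gl c x 0; rewrite addr0 => ->.
    by rewrite [g 0](_ : _ = 0) ?addr0// /g scaler0 q0 oppr0.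
  by rewrite /= mulNr opprK -!expr2.
have gb : g \in linear_bounded V R[i]^o by apply/asboolP; split=> //; exists K.
exists (Bop gb); first exact: opnorm_le.
move=> s; rewrite /= /g -linearZ !qT kZ.
by case: (k s) => a b /=; rewrite mul0r mul1r sub0r opprK.
Qed.

(** Extension from the line through [x], parametrized by scalars; the case [x = 0] needs no separate
    treatment. *)
Lemma norming_functional (V : normedModType R[i]) (x : V) :
  exists2 f : dual V, opnorm f <= 1 & f x = (rnorm x)%:C.
Proof.
have Tl : linear (fun c : R[i]^o => c *: x).
  by move=> a c d; rewrite scalerDl scalerA.
have kl : linear (fun c : R[i]^o => c * (rnorm x)%:C : R[i]^o).
  by move=> a c d; rewrite mulrDl scalerAl.
pose T : {linear R[i]^o -> V} :=
  HB.pack (fun c : R[i]^o => c *: x) (GRing.isLinear.Build R[i] R[i]^o V *:%R _ Tl).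
pose k : {linear R[i]^o -> R[i]^o} :=
  HB.pack (fun c : R[i]^o => c * (rnorm x)%:C : R[i]^o)
    (GRing.isLinear.Build R[i] R[i]^o R[i]^o *:%R _ kl).
have [|f f1 fx] := @hahn_banach_factor R[i]^o V T k 1 ler01.
  move=> c; rewrite mul1r rnormZ [k c]mulrC -[leLHS]/(rnorm ((rnorm x)%:C *: c)).
  by rewrite rnormZr ?rnorm_ge0// mulrC.
by exists f => //; have := fx 1; rewrite /= scale1r mul1r.
Qed.

End ComplexHahnBanach.

(** * Positive angles as norm inequalities *)

Section PositiveAngle.
Context {R : realType} {V : normedModType R[i]}.

Lemma angle_gt0 (K M : set V) : M 0 -> (0 < angle K M) = (0 < sin_angle K M).
Proof.
move=> M0; have /andP[a0 api] := angle_itv K M0.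
rewrite -(sin_angleE K M0); apply/idP/idP => [a_gt0|].
  rewrite sin_gt0_pi// a_gt0 (le_lt_trans api)// ltr_pdivrMr//.
  by rewrite ltr_pMr ?pi_gt0// ltr1n.
by rewrite !lt_neqAle a0 andbT; apply: contraTneq => <-; rewrite sin0 eqxx.
Qed.

(** Homogeneity removes the normalization of [x] from the infimum; under the convention for trivial
    subspaces [c = 1] works. *)
Lemma theta_gt0P (T : bop V V) : 0 < theta T <->
  exists2 c : R, 0 < c & forall x y, T x = 0 -> c * rnorm x <= rnorm (x - T y).
Proof.
have N0 : nullspace T 0 by rewrite /nullspace /= linear0.
have R0 : range T 0 by exists 0; rewrite ?linear0.
rewrite /theta angle_gt0// /sin_angle; case: asboolP => [triv|ntriv].
  split=> // _; exists 1 => // x y Tx; rewrite mul1r.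
  have [/seteqP[N _]|/seteqP[Rg _]] := triv.
    by rewrite (N x Tx) rnorm0 rnorm_ge0.
  by rewrite (Rg (T y) (imageT _ y)) subr0.
set S := [set r | _].
have Slb : has_lbound S by exists 0 => _ [x [y [_ _ _ ->]]]; exact: rnorm_ge0.
have unit x : x != 0 -> rnorm ((rnorm x)^-1%:C *: x) = 1.
  move=> /rnorm_gt0 x0; rewrite rnormZr ?invr_ge0 ?(ltW x0)//.
  by rewrite mulVf// gt_eqF.
split=> [S0|[c c0 cT]].
  exists (inf S) => // x y Tx.
  have [->|x0] := eqVneq x 0; first by rewrite rnorm0 mulr0 rnorm_ge0.
  have nx0 := rnorm_gt0 x x0; have nxV : 0 <= (rnorm x)^-1 by rewrite invr_ge0 ltW.
  rewrite -ler_pdivlMr// mulrC -rnormZr//; apply: ge_inf => //.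
  exists ((rnorm x)^-1%:C *: x), (T ((rnorm x)^-1%:C *: y)); split.
  - by rewrite /nullspace/= linearZ/= Tx scaler0.
  - exact: unit.
  - exact: imageT.
  - by rewrite linearZ/= -scalerBr.
apply: lt_le_trans c0 _; apply: lb_le_inf.
  (* Nonemptiness matters, as the infimum of the empty set is 0: a normalized nonzero null vector
     paired with 0 gives an element. *)
  apply: contrapT => S0; apply: ntriv; left; apply/seteqP; split=> [x Tx|_ ->//].
  apply: contrapT => /eqP x0; apply: S0; eexists.
  exists ((rnorm x)^-1%:C *: x), 0; split; [|exact: unit|exact: R0|reflexivity].
  by rewrite /nullspace/= linearZ/= Tx scaler0.
by move=> _ [x [_ [Tx x1 [y _ <-] ->]]]; have := cT x y Tx; rewrite x1 mulr1.
Qed.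

(* [T u = T (T x)] with [u] short puts [u - T x] in the null space of [T],
   which the angle keeps away from the range. *)
Lemma lower_bound_on_range (T : bop V V) (K : R) : 0 <= K -> 0 < theta T ->
  (forall y, exists2 x, T x = T y & rnorm x <= K * rnorm (T y)) ->
  exists2 C : R, 0 <= C & forall x, rnorm (T x) <= C * rnorm (T (T x)).
Proof.
move=> K0 /theta_gt0P[c c0 cT] lift.
exists ((c^-1 + 1) * K) => [|x].
  by rewrite mulr_ge0 ?addr_ge0 ?invr_ge0 ?(ltW c0).
have [u Tu uK] := lift (T x).
have Tux : T (u - T x) = 0 by rewrite linearB/= Tu subrr.
(* Choosing [- x] turns the right-hand side of the angle inequality into the norm of [u]. *)
have := cT _ (- x) Tux; rewrite linearN opprK subrK -ler_pdivlMl// => h.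
rewrite -mulrA (@le_trans _ _ ((c^-1 + 1) * rnorm u))//; last first.
  by rewrite ler_wpM2l// addr_ge0// invr_ge0 ltW.
rewrite mulrDl mul1r -[T x in leLHS](subKr u) (le_trans (ler_rnormD _ _))//.
by rewrite rnormN addrC lerD.
Qed.

End PositiveAngle.

(** * Rank-one operators and their norms *)

Section RankOne.
Context {R : realType} {U V : normedModType R[i]}.

Lemma linear_bounded_rank_one (x : V) (f : dual U) :
  (fun u => f u *: x) \in linear_bounded U V.
Proof.
apply/asboolP; split=> [a u v|]; first by rewrite linearP scalerDl scalerA.
exists (opnorm f * rnorm x) => u; rewrite rnormZ mulrAC ler_wpM2r ?rnorm_ge0//.
exact: (le_opnorm f).
Qed.

Definition rank_one (x : V) (f : dual U) : bop U V :=
  Bop (linear_bounded_rank_one x f).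

Lemma opnorm_rank_one x f : opnorm (rank_one x f) = rnorm x * opnorm f.
Proof.
apply/le_anti/andP; split.
  apply: opnorm_le => [|u]; first by rewrite mulr_ge0 ?opnorm_ge0 ?rnorm_ge0.
  by rewrite rnormZ mulrC -mulrA ler_wpM2l ?rnorm_ge0//; exact: (le_opnorm f).
have [->|/rnorm_gt0 x0] := eqVneq x 0; first by rewrite rnorm0 mul0r opnorm_ge0.
rewrite -ler_pdivlMl//; apply: opnorm_le => [|u].
  by rewrite mulr_ge0 ?opnorm_ge0 ?invr_ge0 ?rnorm_ge0.
rewrite -mulrA ler_pdivlMl// mulrC -[leLHS]rnormZ.
exact: (le_opnorm (rank_one x f)).
Qed.

Lemma rank_oneBl x y f : rank_one (x - y) f = rank_one x f - rank_one y f.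
Proof. by apply: bop_ext => u; exact: scalerBr. Qed.

Lemma rank_oneBr x f g : rank_one x (f - g) = rank_one x f - rank_one x g.
Proof. by apply: bop_ext => u; exact: scalerBl. Qed.

End RankOne.

(** * The angle of the multiplication operator *)

Section Multiplication.
Context {R : realType} {X : completeNormedModType R[i]}.
Implicit Types A B : bop X X.

Lemma bop_neq0 (U V : normedModType R[i]) (T : bop U V) :
  T <> 0 -> exists x, T x != 0.
Proof.
move=> T0; apply: contrapT => no; apply: T0; apply: bop_ext => x.
by apply: contrapT => /eqP Tx; apply: no; exists x.
Qed.

(** Evaluating [h] at [B y] through a short lift of [B y] bounds [h] on the range of [B] by [K]
    times the norm of [adjoint B h]; [g] is a Hahn-Banach extension of that restriction. *)
Lemma adjoint_lift (U V : normedModType R[i]) (B : bop U V) (K : R) : 0 <= K ->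
  (forall y, exists2 x, B x = B y & rnorm x <= K * rnorm (B y)) ->
  forall h, exists2 g, adjoint B g = adjoint B h &
    rnorm g <= K * rnorm (adjoint B h).
Proof.
move=> K0 lift h.
have [||g gK gB] :=
  @hahn_banach_factor R U V B (adjoint B h) (K * opnorm (adjoint B h)).
- by rewrite mulr_ge0 ?opnorm_ge0.
- move=> s; have [s' Bs' s'K] := lift s.
  rewrite -[leLHS]/(rnorm (adjoint B h s)).
  have -> : adjoint B h s = adjoint B h s' by rewrite /= Bs'.
  rewrite (le_trans (le_opnorm (adjoint B h) s'))// mulrAC [leRHS]mulrC.
  by rewrite ler_wpM2l ?opnorm_ge0.
by exists g => //; apply: bop_ext => s; rewrite /= gB.
Qed.

Lemma theta_mulop_left A B : B <> 0 -> 0 < theta (mulop A B) -> 0 < theta A.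
Proof.
move=> B0 /theta_gt0P[c c0 cT].
have [b Bb] := bop_neq0 _ _ _ B0.
have [g _ gb] := norming_functional _ (B b).
(* This is the common factor of all the rank-one norms below, and it is cancelled at the end. *)
have gB : 0 < opnorm (adjoint B g).
  apply: (@rnorm_gt0 _ _ (adjoint B g)); apply: contra_neq Bb => Bg0.
  apply: rnorm0_eq0; have /(congr1 (fun f : dual X => f b)) := Bg0.
  by rewrite /= gb => -[].
apply/theta_gt0P; exists c => // x y Ax.
have /(cT _ (rank_one y g)) : mulop A B (rank_one x (adjoint B g)) = 0.
  by apply: bop_ext => z; rewrite /= linearZ/= Ax scaler0.
have -> : mulop A B (rank_one y g) = rank_one (A y) (adjoint B g).
  by apply: bop_ext => z; rewrite /= linearZ.
by rewrite -rank_oneBl !rnorm_bop !opnorm_rank_one mulrA ler_pM2r.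
Qed.

Lemma theta_mulop_right A B : A <> 0 -> 0 < theta (mulop A B) ->
  0 < theta (adjoint B).
Proof.
move=> A0 /theta_gt0P[c c0 cT].
have [a /rnorm_gt0 Aa] := bop_neq0 _ _ _ A0.
apply/theta_gt0P; exists c => // f g Bf.
have /(cT _ (rank_one a g)) : mulop A B (rank_one (A a) f) = 0.
  apply: bop_ext => z; have /(congr1 (fun f : dual X => f z)) := Bf.
  by rewrite /= linearZ/= => ->; rewrite scale0r.
have -> : mulop A B (rank_one a g) = rank_one (A a) (adjoint B g).
  by apply: bop_ext => z; rewrite /= linearZ.
by rewrite -rank_oneBr !rnorm_bop !opnorm_rank_one mulrCA ler_pM2l.
Qed.

Lemma theta_mulop_gt0 A B : 0 < theta A -> 0 < theta (adjoint B) ->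
  closed (range A) -> closed (range B) -> 0 < theta (mulop A B).
Proof.
move=> tA tB /closed_range_lift[KA KA0 liftA] /closed_range_lift[KB KB0 liftB].
have [CA CA0 lbA] := lower_bound_on_range A KA KA0 tA liftA.
have [CB CB0 lbB] := lower_bound_on_range (adjoint B) KB KB0 tB
  (adjoint_lift _ _ B KB KB0 liftB).
pose C := CB * (CA * opnorm A * opnorm B).
have C0 : 0 <= C by rewrite !mulr_ge0 ?opnorm_ge0.
(* The constant comes from [S = Z + W] once [W] is bounded by [C] times the norm of [Z]. *)
apply/theta_gt0P; exists (1 + C)^-1 => [|S Y ASB]; first by rewrite invr_gt0; lra.
set W := mulop A B Y; set Z := S - W.
have WB x : rnorm (W (B x)) <= CA * opnorm A * opnorm B * opnorm Z * rnorm x.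
  have AWB : A (W (B x)) = - A (Z (B x)).
    apply/eqP; rewrite -addr_eq0 -(linearD A) -[_ + _]/((W + Z) (B x)) addrC subrK.
    by rewrite -[eqbLHS]/(mulop A B S x) ASB.
  apply: le_trans (lbA _) _; rewrite -!mulrA ler_wpM2l//.
  rewrite -[A (A _)]/(A (W (B x))) AWB.
  rewrite rnormN (le_trans (le_opnorm _ _))// ler_wpM2l ?opnorm_ge0//.
  rewrite (le_trans (le_opnorm _ _))// mulrCA ler_wpM2l ?opnorm_ge0//.
  exact: le_opnorm.
have Wle : opnorm W <= C * opnorm Z.
  apply: opnorm_le => [|x]; first by rewrite mulr_ge0 ?opnorm_ge0.
  have [f f1 fx] := norming_functional _ (W x).
  (* Then [adjoint B g] is [f] composed with [W], and a further [adjoint B] composes it with [B],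
     where [WB] applies. *)
  pose g : dual X := bop_comp f (bop_comp A Y).
  have gx : adjoint B g x = (rnorm (W x))%:C by [].
  have := le_opnorm (adjoint B g) x.
  rewrite {1}/rnorm gx ger0_norm ?lecR ?rnorm_ge0//= => /le_trans; apply.
  rewrite ler_wpM2r ?rnorm_ge0// (le_trans (lbB g))// -mulrA ler_wpM2l//.
  apply: opnorm_le => [|y]; first by rewrite !mulr_ge0 ?opnorm_ge0.
  rewrite (le_trans (le_opnorm f _))// (le_trans _ (WB y))//.
  by rewrite ler_piMl ?rnorm_ge0.
rewrite ler_pdivrMl; last lra.
rewrite !rnorm_bop -[S](subrK W) (le_trans (ler_opnormD _ _))// mulrDl mul1r.
by rewrite lerD.
Qed.

End Multiplication.

Theorem theorem4 (R : realType) (X : completeNormedModType R[i])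
    (A B : bop X X) (A_neq0 : A <> 0) (B_neq0 : B <> 0) :
  (0 < theta (mulop A B) -> 0 < theta A /\ 0 < theta (adjoint B)) /\
  (0 < theta A -> 0 < theta (adjoint B) ->
   closed (range A) -> closed (range B) -> 0 < theta (mulop A B)).
Proof.
split=> [t|]; last exact: theta_mulop_gt0.
by split; [exact: theta_mulop_left t|exact: theta_mulop_right t].
Qed.
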